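(* Let $\mathcal{E}=(V\cup K;\alpha,\omega,{}^{-1})$ be a finite graph, $\ell\colon K\to 2^F$, $k\mapsto g_kH_k$ a coset labelling and $(X_k)_{k\in K}$ variables. Then there exists a finite index normal subgroup $N$ of $F$ such that: if the system of equations \[X_{k_1}\cdots X_{k_t}=1_F\colon\ k_1\cdots k_t\text{ a closed path in }\mathcal{E}\] has no solution in $F^K$ subject to the constraints $X_k\in g_kH_k$ ($k\in K$), then it even has no solution subject to the constraints $X_k\in g_kH_kN$ ($k\in K$).
   Context: $F$ is the free group on a finite set $A$. A graph $\mathcal{E}=(V\cup K;\alpha,\omega,{}^{-1})$ has vertex set $V$, disjoint edge set $K$, maps $\alpha,\omega\colon K\to V$ and an involution ${}^{-1}$ on $K$ with $\alpha e=\omega e^{-1}$, $\omega e=\alpha e^{-1}$ and $e\ne e^{-1}$ (loops and multiple edges allowed). A closed path is a sequence $k_1\cdots k_t$ of edges with $\omega k_i=\alpha k_{i+1}$ for $1\le i<t$ and $\omega k_t=\alpha k_1$. A (left) coset labelling of $\mathcal{E}$ is a map $\ell\colon K\to 2^F$ such that each $\ell(k)=g_kH_k$ with $H_k$ a finitely generated subgroup of $F$ and $g_k\in F$, and $\ell(k^{-1})=\ell(k)^{-1}$ (the set of inverses of elements of $\ell(k)$) for all $k\in K$. *)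

(* Defs.v *)
From HB Require Import structures.
From mathcomp Require Import all_boot.
From mathcomp Require Import boolp classical_sets cardinality.

Set Implicit Arguments.
Unset Strict Implicit.
Unset Printing Implicit Defensive.

Local Open Scope classical_set_scope.
Local Open Scope group_scope.

Section FreeGroup.
Variable A : finType.

(* The letter [(a, false)] is the generator [a], and [(a, true)] is its formal
   inverse. *)
Definition letter : Type := (A * bool)%type.

Definition linv (x : letter) : letter := (x.1, ~~ x.2).

Definition reduced (w : seq letter) : bool :=
  sorted (fun x y => y != linv x) w.

Record free_group : Type :=
  FreeGroup { fgword : seq letter; fgword_reduced : reduced fgword }.

HB.instance Definition _ := [isSub for fgword].
HB.instance Definition _ := [Choice of free_group by <:].

(* [push x w] is the reduced form of [x :: w] when [w] is reduced. *)
Definition push (x : letter) (w : seq letter) : seq letter :=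
  if w is y :: w' then (if y == linv x then w' else x :: w) else [:: x].

Definition reduce (w : seq letter) : seq letter := foldr push [::] w.

Lemma linvK : involutive linv.
Proof. by case=> a b; rewrite /linv /= negbK. Qed.

Lemma reduced_push x w : reduced w -> reduced (push x w).
Proof.
case: w => [|y w] //=; case: ifP => [_ /path_sorted //|yx rw].
by rewrite /reduced /= yx.
Qed.

Lemma reduced_foldr u w : reduced w -> reduced (foldr push w u).
Proof. by move=> rw; elim: u => //= x u IHu; apply: reduced_push. Qed.

Lemma pushK x w : reduced w -> push x (push (linv x) w) = w.
Proof.
case: w => [|y w] /=; first by rewrite eqxx.
rewrite linvK; have [-> rw|_ _] := eqVneq y x; last by rewrite /= eqxx.
case: w rw => [|z w] //= /andP[zx _].
by rewrite (negbTE zx).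
Qed.

Lemma reduced_reduce u : reduced (reduce u).
Proof. exact: reduced_foldr. Qed.

Lemma foldr_push x r w :
  reduced w -> foldr push w (push x r) = push x (foldr push w r).
Proof.
case: r => [|y r] //= rw; case: eqP => [->|//].
by rewrite pushK //; apply: reduced_foldr.
Qed.

Lemma foldr_reduce u w : reduced w -> foldr push w (reduce u) = foldr push w u.
Proof. by move=> rw; elim: u => //= x u IHu; rewrite foldr_push // IHu. Qed.

Lemma reduce_id w : reduced w -> reduce w = w.
Proof.
elim: w => //= x w IHw rw; rewrite IHw; last exact: path_sorted rw.
by case: w rw {IHw} => [|y w] //; rewrite /reduced /= => /andP[/negbTE ->].
Qed.

Lemma reduced_linv w : reduced w -> reduced (rev (map linv w)).
Proof.
rewrite /reduced rev_sorted sorted_map; apply: sub_sorted => x y /=.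
by rewrite linvK eq_sym.
Qed.

Definition fg_one : free_group := @FreeGroup [::] isT.

Definition fg_mul (u v : free_group) : free_group :=
  FreeGroup (reduced_reduce (fgword u ++ fgword v)).

Definition fg_inv (u : free_group) : free_group :=
  FreeGroup (reduced_linv (fgword_reduced u)).

Lemma fgword_inj : injective fgword.
Proof. exact: val_inj. Qed.

Lemma fg_mulE u v : fgword (fg_mul u v) = foldr push (fgword v) (fgword u).
Proof.
rewrite /= /reduce foldr_cat; congr foldr.
exact/reduce_id/fgword_reduced.
Qed.

Lemma fg_mulA : associative fg_mul.
Proof.
move=> u v w; apply: fgword_inj; have rw := fgword_reduced w.
by rewrite [LHS]fg_mulE [RHS]fg_mulE fg_mulE /= foldr_reduce // foldr_cat.
Qed.

Lemma fg_mul1 : left_id fg_one fg_mul.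
Proof. by move=> u; apply: fgword_inj; rewrite fg_mulE. Qed.

Lemma fg_mulg1 : right_id fg_one fg_mul.
Proof.
by move=> u; apply: fgword_inj; rewrite fg_mulE; apply/reduce_id/fgword_reduced.
Qed.

Lemma fg_mulV : left_inverse fg_one fg_inv fg_mul.
Proof.
move=> u; apply: fgword_inj; rewrite fg_mulE /=; case: u => w /= rw.
elim: w rw => //= x w IHw rw; rewrite rev_cons foldr_rcons /= linvK eqxx.
exact/IHw/(path_sorted rw).
Qed.

Lemma fg_mulgV : right_inverse fg_one fg_inv fg_mul.
Proof.
have invK : involutive fg_inv.
  move=> u; apply: fgword_inj; rewrite /= map_rev revK -map_comp.
  by rewrite map_id_in // => x _ /=; rewrite linvK.
by move=> u; rewrite -{1}[u]invK fg_mulV.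
Qed.

HB.instance Definition _ :=
  isGroup.Build free_group fg_mulA fg_mul1 fg_mulg1 fg_mulV fg_mulgV.

End FreeGroup.

Section Subgroups.
Variable G : groupType.
Implicit Types (g : G) (H N B C : set G).

Definition subgroup H : Prop := group_closed (mem H).

Definition finitely_generated H : Prop :=
  exists2 B, finite_set B & H = smallest subgroup B.

Definition mulset B C : set G := [set x * y | x in B & y in C].

Definition invset B : set G := [set x^-1 | x in B].

Definition lcoset g H : set G := [set g * h | h in H].

Definition normal_subgroup N : Prop :=
  subgroup N /\ forall x g, N x -> N (x ^ g).

Definition finite_index N : Prop := finite_set [set lcoset g N | g in setT].

End Subgroups.

Record fin_graph : Type := FinGraph {
  vertex : finType;
  edge : finType;
  src : edge -> vertex;
  tgt : edge -> vertex;
  einv : edge -> edge;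
  einvK : involutive einv;
  src_einv : forall e, src e = tgt (einv e);
  tgt_einv : forall e, tgt e = src (einv e);
  einv_neq : forall e, e <> einv e }.

Definition closed_path (E : fin_graph) (p : seq (edge E)) : bool :=
  (p != [::]) && cycle (fun k k' => tgt k == src k') p.

(* The representatives [g] and the subgroups [H] of the cosets [ell k] are part
   of the data. *)
Definition coset_labelling (A : finType) (E : fin_graph)
    (ell : edge E -> set (free_group A))
    (g : edge E -> free_group A) (H : edge E -> set (free_group A)) : Prop :=
  [/\ forall k, finitely_generated (H k),
      forall k, ell k = lcoset (g k) (H k) &
      forall k, ell (einv k) = invset (ell k)].

Definition solvable_in (G : groupType) (E : fin_graph)
    (C : edge E -> set G) : Prop :=
  exists X : edge E -> G,
    (forall p : seq (edge E), closed_path p -> \prod_(k <- p) X k = 1) /\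
    (forall k, C k (X k)).

(* Main.v *)
(** A family [X] has product 1 along all closed paths iff it is the coboundary
    [X k = (phi (src k))^-1 * phi (tgt k)] of a potential [phi] on the vertices.
    Each coset [g_k H_k] is the set of labels of paths between two states of a
    finite piece of the Schreier graph of [H_k], which extends to a finite
    permutation automaton.  The constraints then form a finite hypergraph system:
    the variables of the hyperedge [k] are to lie, with given states, on one
    component of the graph obtained by pulling the automaton back to the Cayley
    graph.

    Starting from this automaton, pass repeatedly from a finite [F]-set to the
    [F]-set that moreover records the parity of the number of traversals of each
    edge.  A solution at level [m.+1] gives a solution in [F], by induction on
    [m], once [m] bounds the number of variables plus the number of missing
    incidences.  Pick a variable [v] and let [D] be the component, at level [m],
    of the intersection of the pieces of the hyperedges at [v].
    - If removing [v] and the hyperedges at [v] disconnects the hypergraph, solve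
      both sides and glue them at [v].
    - If [D] meets the piece of a hyperedge not containing [v], move [v] to that
      place: this adds an incidence, and a solution of the new system gives one of
      the old system by moving back.
    - Otherwise, the path from [v] to any other variable crosses each boundary
      edge of [D] an even number of times, so that all variables lie in [D], and
      labels of paths inside [D] form a solution in [F]. *)

Require Import Defs.
From HB Require Import structures.
From mathcomp Require Import all_boot.
From mathcomp Require Import boolp classical_sets cardinality.
Import fintype boot.finset.

Set Implicit Arguments.
Unset Strict Implicit.
Unset Printing Implicit Defensive.

Local Open Scope group_scope.

(** * Permutation actions of the letters *)

Section LetterActions.
Variable A : finType.
Implicit Types (x : letter A) (w : seq (letter A)).

(** As [linv] is an involution, this one equation makes [x] and [linv x] act as mutually inverse
    permutations. *)
Definition letter_action T (act : T -> letter A -> T) : Prop :=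
  forall t x, act (act t x) (linv x) = t.

Definition run T (act : T -> letter A -> T) (t : T) (w : seq (letter A)) : T :=
  foldl act t w.

Definition winv w : seq (letter A) := rev (map (@linv A) w).

Lemma run_cat T (act : T -> letter A -> T) t w w' :
  run act t (w ++ w') = run act (run act t w) w'.
Proof. exact: foldl_cat. Qed.

Lemma winv_cons x w : winv (x :: w) = winv w ++ [:: linv x].
Proof. by rewrite /winv /= rev_cons cats1. Qed.

Lemma run_winv T (act : T -> letter A -> T) t w :
  letter_action act -> run act (run act t w) (winv w) = t.
Proof.
move=> actK; elim: w t => //= x w IHw t.
by rewrite winv_cons run_cat IHw /= actK.
Qed.

Lemma winvK w : winv (winv w) = w.
Proof.
by rewrite /winv map_rev revK -map_comp map_id_in // => x _; apply: linvK.
Qed.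

Lemma run_winvK T (act : T -> letter A -> T) t w :
  letter_action act -> run act (run act t (winv w)) w = t.
Proof. by move=> actK; rewrite -{2}[w]winvK run_winv. Qed.

Lemma run_reduce T (act : T -> letter A -> T) t w :
  letter_action act -> run act t (reduce w) = run act t w.
Proof.
move=> actK; have run_push s x r : run act s (push x r) = run act (act s x) r.
  by case: r => [|y r] //=; case: eqP => [->|//] /=; rewrite actK.
by elim: w t => //= x w IHw t; rewrite run_push IHw.
Qed.

Lemma run_fgM T (act : T -> letter A -> T) t (y z : free_group A) :
    letter_action act ->
  run act t (fgword (y * z)) = run act (run act t (fgword y)) (fgword z).
Proof. by move=> actK; rewrite -run_cat run_reduce. Qed.

Definition fg_gen x : free_group A := @FreeGroup _ [:: x] isT.

(** The Cayley graph of $F$. *)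
Definition fg_act (y : free_group A) x : free_group A := y * fg_gen x.

Lemma fg_actK : letter_action fg_act.
Proof.
move=> y x; rewrite /fg_act -mulgA -[RHS]mulg1; congr (_ * _).
by apply: fgword_inj; rewrite /= eqxx.
Qed.

Definition word_value w : free_group A := run fg_act 1 w.

Lemma run_fg_act y w : run fg_act y w = y * word_value w.
Proof.
rewrite /word_value -{1}[y]mulg1; elim/last_ind: w => [|w x IHw] //.
by rewrite -cats1 !run_cat /= IHw /fg_act mulgA.
Qed.

Lemma word_value_cons x w : word_value (x :: w) = fg_gen x * word_value w.
Proof. by rewrite {1}/word_value /= run_fg_act /fg_act mul1g. Qed.

Lemma fgword_word_value w : fgword (word_value w) = reduce w.
Proof. by elim: w => //= x w IHw; rewrite -IHw word_value_cons fg_mulE. Qed.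

Lemma word_value_fgword y : word_value (fgword y) = y.
Proof.
by apply: fgword_inj; rewrite fgword_word_value reduce_id ?fgword_reduced.
Qed.

Lemma run_word_value T (act : T -> letter A -> T) t w :
  letter_action act -> run act t (fgword (word_value w)) = run act t w.
Proof. by move=> actK; rewrite fgword_word_value run_reduce. Qed.

End LetterActions.

(** * Pieces of permutation automata and their pullbacks *)

Section PartialAutomaton.
Variables (A Q : finType) (delta : Q -> letter A -> Q).
Hypothesis deltaK : letter_action delta.
(** [ok] marks the transitions of the finite piece inside the complete automaton [delta]. *)
Variable ok : Q -> letter A -> bool.
Hypothesis okV : forall q x, ok (delta q x) (linv x) = ok q x.
Implicit Types (q : Q) (x : letter A) (w : seq (letter A)).

Fixpoint okw q w : bool :=
  if w is x :: w' then ok q x && okw (delta q x) w' else true.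

Lemma okw_cat q w w' : okw q (w ++ w') = okw q w && okw (run delta q w) w'.
Proof. by elim: w q => //= x w IHw q; rewrite IHw andbA. Qed.

Lemma okw_winv q w : okw (run delta q w) (winv w) = okw q w.
Proof.
elim: w q => //= x w IHw q; rewrite winv_cons okw_cat IHw /=.
by rewrite run_winv // okV andbT andbC.
Qed.

Section Connection.
Variables (T : Type) (act : T -> letter A -> T).
Hypothesis actK : letter_action act.
Implicit Types t : T.

Definition conn q t q' t' : Prop :=
  exists w, [/\ okw q w, run delta q w = q' & run act t w = t'].

Lemma conn_refl q t : conn q t q t.
Proof. by exists [::]. Qed.

Lemma conn_run q t w : okw q w -> conn q t (run delta q w) (run act t w).
Proof. by exists w. Qed.

Lemma conn_sym q t q' t' : conn q t q' t' -> conn q' t' q t.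
Proof.
by case=> w [okqw <- <-]; exists (winv w); rewrite okw_winv !run_winv.
Qed.

Lemma conn_trans q t q' t' q'' t'' :
  conn q t q' t' -> conn q' t' q'' t'' -> conn q t q'' t''.
Proof.
move=> [w [okw1 <- <-]] [w' [okw2 <- <-]]; exists (w ++ w').
by rewrite okw_cat okw1 !run_cat.
Qed.

Variables V K : finType.

(* The hyperedge [k] requires its variables to lie on a common component of the
   pullback of the automaton, with the states prescribed by [st]. *)
Definition solution (inc : K -> {set V}) (st : K -> V -> Q) (tau : V -> T) :
    Prop :=
  forall k u u', u \in inc k -> u' \in inc k ->
  conn (st k u) (tau u) (st k u') (tau u').

Lemma solution_sub (inc inc' : K -> {set V}) (st : K -> V -> Q) (tau : V -> T) :
  (forall k, inc' k \subset inc k) ->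
  solution inc st tau -> solution inc' st tau.
Proof.
by move=> sub sol k u u' /(subsetP (sub k)) ? /(subsetP (sub k)) ?; apply: sol.
Qed.

End Connection.

(** Left multiplication is an automorphism of the Cayley graph. *)
Lemma conn_mul q q' y y' (z : free_group A) :
  conn (@fg_act A) q y q' y' -> conn (@fg_act A) q (z * y) q' (z * y').
Proof.
by case=> w [? ? <-]; exists w; split; rewrite // !run_fg_act mulgA.
Qed.

(** * Edges of an action and the tower of parity covers *)

(** An edge is named by its positive generator and the point where that is read, so both directions
    of traversal get one name. *)
Definition act_edge T (act : T -> letter A -> T) (t : T) x : T * A :=
  if x.2 then (act t x, x.1) else (t, x.1).

Lemma act_edge_linv T (act : T -> letter A -> T) t x :
  letter_action act -> act_edge act (act t x) (linv x) = act_edge act t x.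
Proof. by move=> actK; rewrite /act_edge actK /=; case: x.2. Qed.

Lemma act_edge_inj T (act : T -> letter A -> T) t x t' x' :
    letter_action act -> act_edge act t x = act_edge act t' x' ->
  (t = t' /\ x = x') \/ (t = act t' x' /\ x' = linv x).
Proof.
move=> actK; case: x x' => [a [|]] [a' [|]]; rewrite /act_edge /linv /=.
- case=> eqt eqa; subst a'; left; split => //.
  by rewrite -[t](actK _ (a, true)) eqt actK.
- case=> eqt eqa; subst a'; right; split => //.
  by rewrite -[t](actK _ (a, true)) eqt.
- by case=> -> ->; right.
- by case=> -> ->; left.
Qed.

Lemma act_edge_surj (T : Type) (act : T -> letter A -> T) (D : T -> bool) e :
    letter_action act -> D e.1 != D (act e.1 (e.2, false)) ->
  exists t x, [/\ act_edge act t x = e, D t & ~~ D (act t x)].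
Proof.
move=> actK; case: e => t a /=; case Dt: (D t) => Dt'.
  by exists t, (a, false).
exists (act t (a, false)), (a, true); rewrite -[(a, true)]/(linv (a, false)).
by rewrite act_edge_linv // actK Dt; split => //; case: (D _) Dt'.
Qed.

(* A point of level [m.+1] over a vertex of level [m] records, for every edge of
   level [m], the parity of the number of times the edge was traversed. *)
Fixpoint level (m : nat) : finType :=
  if m is m'.+1 then (level m' * {ffun level m' * A -> bool})%type
  else {ffun Q -> Q}.

Fixpoint level_act (m : nat) : level m -> letter A -> level m :=
  match m return level m -> letter A -> level m with
  | 0 => fun t x => [ffun q => delta (t q) x]
  | m'.+1 => fun t x =>
      (level_act t.1 x,
       [ffun e => t.2 e (+) (e == act_edge (@level_act m') t.1 x)])
  end.

Fixpoint base (m : nat) : level m :=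
  match m return level m with
  | 0 => [ffun q => q]
  | m'.+1 => (base m', [ffun => false])
  end.

Lemma level_actK m : letter_action (@level_act m).
Proof.
elim: m => [t|m IHm [t f]] x /=.
  by apply/ffunP => q; rewrite !ffunE deltaK.
rewrite IHm act_edge_linv //; congr pair.
by apply/ffunP => e; rewrite !ffunE addbK.
Qed.

Definition endpoint m w : level m := run (@level_act m) (base m) w.
Arguments endpoint : clear implicits.

Lemma run_level_fst m (t : level m.+1) w :
  (run (@level_act m.+1) t w).1 = run (@level_act m) t.1 w.
Proof. by elim: w t => //= x w IHw t; rewrite IHw. Qed.

Lemma endpoint_fst m w : (endpoint m.+1 w).1 = endpoint m w.
Proof. exact: run_level_fst. Qed.

(** At level 0 the endpoint is the map of [Q] induced by the word, and higher levels project to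
    it. *)
Lemma endpoint_delta m w w' :
  endpoint m w = endpoint m w' -> forall q, run delta q w = run delta q w'.
Proof.
elim: m => [|m IHm] eqp q; last first.
  by apply: IHm; have := congr1 fst eqp; rewrite !endpoint_fst.
have runE (t : level 0) u : run (@level_act 0) t u q = run delta (t q) u.
  by elim: u t => //= x u IHu t; rewrite IHu ffunE.
by have /ffunP/(_ q) := eqp; rewrite !runE ffunE.
Qed.

Lemma traversal m (t : level m.+1) w e :
    (run (@level_act m.+1) t w).2 e != t.2 e ->
  exists w1 x w2,
    w = w1 ++ x :: w2 /\
    act_edge (@level_act m) (run (@level_act m) t.1 w1) x = e.
Proof.
elim: w t => [|x w IHw] t /=; first by rewrite eqxx.
have [->|ne] := eqVneq e (act_edge (@level_act m) t.1 x).
  by move=> _; exists [::], x, w.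
move=> odd_e; have [|w1 [y [w2 [-> <-]]]] := IHw (@level_act m.+1 t x).
  by rewrite /= ffunE (negbTE ne) addbF.
by exists (x :: w1), y, w2.
Qed.

(** Membership in [D] switches exactly at traversals of boundary edges, whose parities are
    recorded. *)
Lemma crossing_parity m (D : level m -> bool) (t : level m.+1) w :
  D (run (@level_act m) t.1 w) = D t.1 (+)
    \big[addb/false]_(e | D e.1 != D (level_act e.1 (e.2, false)))
      (t.2 e (+) (run (@level_act m.+1) t w).2 e).
Proof.
elim: w t => [|x w IHw] t /=.
  by rewrite big1 ?addbF // => e _; rewrite addbb.
rewrite (IHw (@level_act m.+1 t x)) /=.
set e0 := act_edge _ _ _.
under eq_bigr => e _ do rewrite ffunE -addbA [(e == _) (+) _]addbC addbA.
rewrite big_split addbA addbAC; congr addb; rewrite /=.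
have -> :
    \big[addb/false]_(e | D e.1 != D (level_act e.1 (e.2, false))) (e == e0)
    = (D e0.1 != D (level_act e0.1 (e0.2, false))).
  rewrite big_mkcond (bigD1 e0) //= eqxx big1 ?addbF; first by case: ifP.
  by move=> e /negbTE ->; case: ifP.
rewrite /e0 /act_edge; case: x {e0} => a [|] /=; last by do 2!case: (D _).
by have := level_actK t.1 (a, true); rewrite /linv /= => ->; do 2!case: (D _).
Qed.

(** * Lifting solutions from a finite level to the free group *)

Section Lifting.
Variables V K : finType.
Implicit Types (inc : K -> {set V}) (st : K -> V -> Q).

(** Both solutions are translated to take the value $1$ at [v]; a hyperedge meeting both [W] and its
    complement contains [v]. *)
Lemma solution_glue inc st v (W : {set V}) (y1 y2 : V -> free_group A) :
    v \notin W ->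
    (forall k u u', v \notin inc k -> u \in inc k -> u' \in inc k ->
      u \in W -> u' \in W) ->
    solution (@fg_act A) (fun k => inc k :&: (v |: W)) st y1 ->
    solution (@fg_act A) (fun k => inc k :\: W) st y2 ->
  exists y, solution (@fg_act A) inc st y.
Proof.
move=> nWv closedW sol1 sol2.
pose y u := if u \in W then (y1 v)^-1 * y1 u else (y2 v)^-1 * y2 u.
exists y => k.
have inW u u' : u \in inc k -> u' \in inc k -> u \in v |: W -> u' \in v |: W ->
    conn (@fg_act A) (st k u) ((y1 v)^-1 * y1 u) (st k u') ((y1 v)^-1 * y1 u').
  by move=> *; apply/conn_mul/sol1; rewrite inE; apply/andP.
have outW u u' : u \in inc k -> u' \in inc k -> u \notin W -> u' \notin W ->
    conn (@fg_act A) (st k u) (y u) (st k u') (y u').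
  move=> ku ku' nWu nWu'; rewrite /y (negbTE nWu) (negbTE nWu').
  by apply/conn_mul/sol2; rewrite inE; apply/andP.
have mixed u u' : u \in inc k -> u' \in inc k -> u \in W -> u' \notin W ->
    conn (@fg_act A) (st k u) (y u) (st k u') (y u').
  move=> ku ku' Wu nWu'.
  have kv : v \in inc k.
    by apply: contraNT nWu' => nkv; apply: closedW nkv ku ku' Wu.
  apply: conn_trans (outW v u' kv ku' nWv nWu').
  rewrite /y Wu (negbTE nWv) !mulVg -(mulVg (y1 v)).
  by apply: inW; rewrite // !inE ?eqxx ?Wu ?orbT.
move=> u u' ku ku'.
case: (boolP (u \in W)) (boolP (u' \in W)) => [Wu|nWu] [Wu'|nWu'].
- by rewrite /y Wu Wu'; apply: inW; rewrite // inE ?Wu ?Wu' orbT.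
- exact: mixed.
- by apply: conn_sym; [exact: fg_actK|apply: mixed].
- exact: outW.
Qed.

Section Move.
Variables (T : Type) (act : T -> letter A -> T).
Hypothesis actK : letter_action act.
Variables (inc : K -> {set V}) (st : K -> V -> Q).
Variables (v : V) (w : seq (letter A)) (k0 : K) (q0 : Q).
Hypothesis nk0v : v \notin inc k0.

Definition moved_inc k : {set V} := if k == k0 then v |: inc k else inc k.

(** States at [v] follow [w]. A hyperedge with [v] as its only variable imposes nothing, so [w] may
    leave its piece and its state is kept. *)
Definition moved_st k u : Q :=
  if u == v then
    if k == k0 then q0
    else if inc k == [set v] then st k v else run delta (st k v) w
  else st k u.

Hypothesis okw_v :
  forall k, v \in inc k -> inc k != [set v] -> okw (st k v) w.

Lemma solution_move (tau : V -> T) u0 :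
    u0 \in inc k0 -> conn act (st k0 u0) (tau u0) q0 (run act (tau v) w) ->
    solution act inc st tau ->
  solution act moved_inc moved_st
    (fun u => if u == v then run act (tau v) w else tau u).
Proof.
move=> k0u0 conn0 sol k u1 u2.
have [inc1|ninc1] := eqVneq (inc k) [set v].
  have ne : k != k0 by apply: contraNneq nk0v => <-; rewrite inc1 inE.
  rewrite /moved_inc (negbTE ne) inc1 !inE => /eqP -> /eqP ->; exact: conn_refl.
suff back u : u \in moved_inc k -> exists2 u', u' \in inc k &
    conn act (st k u') (tau u') (moved_st k u)
      (if u == v then run act (tau v) w else tau u).
  move=> /back[u1' ku1' c1] /back[u2' ku2' c2].
  apply: conn_trans (conn_sym actK c1) _; apply: conn_trans c2; exact: sol.
rewrite /moved_inc /moved_st; have [->|nuv] := eqVneq u v; last first.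
  move=> ku; exists u; last exact: conn_refl.
  by move: ku; case: eqP => // _; rewrite !inE (negbTE nuv).
case: eqP => [->|_ kv]; first by exists u0.
rewrite (negbTE ninc1); exists v => //; apply: conn_run; exact: okw_v.
Qed.

Lemma solution_unmove (tau : V -> T) :
    solution act moved_inc moved_st tau ->
  solution act inc st
    (fun u => if u == v then run act (tau v) (winv w) else tau u).
Proof.
move=> sol k u1 u2.
have [inc1|ninc1] := eqVneq (inc k) [set v].
  by rewrite inc1 !inE => /eqP -> /eqP ->; exact: conn_refl.
suff forth u : u \in inc k -> u \in moved_inc k /\
    conn act (st k u) (if u == v then run act (tau v) (winv w) else tau u)
      (moved_st k u) (tau u).
  move=> /forth[ku1 c1] /forth[ku2 c2].
  apply: conn_trans c1 _; apply: conn_trans (conn_sym actK c2); exact: sol.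
move=> ku; split; first by rewrite /moved_inc; case: eqP; rewrite // inE ku orbT.
rewrite /moved_st; have [eqv|nuv] := eqVneq u v; last exact: conn_refl.
have ne : k != k0 by apply: contraNneq nk0v => <-; rewrite -eqv.
rewrite (negbTE ne) (negbTE ninc1) eqv -{2}[tau v](run_winvK _ w actK).
by apply/conn_run/okw_v => //; rewrite -eqv.
Qed.

End Move.

Section Stuck.
Variables (m : nat) (U : {set V}) (inc : K -> {set V}) (st : K -> V -> Q).
Variables (x : V -> seq (letter A)) (v : V).
Hypothesis incU : forall k, inc k \subset U.
Hypothesis sol :
  solution (@level_act m.+1) inc st (fun u => endpoint m.+1 (x u)).

Definition okv w : Prop :=
  forall k, v \in inc k -> inc k != [set v] -> okw (st k v) w.

Hypothesis irreducible : forall W : {set V}, W \subset U :\ v ->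
  (forall k u u', v \notin inc k -> u \in inc k -> u' \in inc k ->
    u \in W -> u' \in W) ->
  W = set0 \/ W = U :\ v.

Hypothesis stuck : forall k u w w',
  v \notin inc k -> u \in inc k -> okv w -> okw (st k u) w' ->
  endpoint m (x u ++ w') <> endpoint m (x v ++ w).

Let D (c : level m) : bool :=
  `[< exists2 w, okv w & endpoint m (x v ++ w) = c >].

(** Let [W] be the variables whose parity at [e] differs from that of [v]. A hyperedge avoiding [v]
    cannot leave [W]: it would traverse [e] and so meet [D]. By irreducibility [W] is empty or
    contains all variables but [v]; the latter would let [D] continue across [e]. *)
Lemma boundary_flow e u : u \in U ->
    D e.1 != D (level_act e.1 (e.2, false)) ->
  (endpoint m.+1 (x u)).2 e = (endpoint m.+1 (x v)).2 e.
Proof.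
move=> Uu /(act_edge_surj (@level_actK m))[y0 [x0 [edge0]]].
move=> /asboolP[w0 okv0 y0E] nDy1.
pose W := [set u in U | (endpoint m.+1 (x u)).2 e != (endpoint m.+1 (x v)).2 e].
have trav k u1 u2 : u1 \in inc k -> u2 \in inc k ->
    (endpoint m.+1 (x u2)).2 e != (endpoint m.+1 (x u1)).2 e ->
    exists w, [/\ okw (st k u1) w, endpoint m (x u1 ++ w) = y0 &
                  ok (run delta (st k u1) w) x0].
  move=> ku1 ku2; have [w [okw12 _ <-]] := sol ku1 ku2.
  case/traversal => w1 [z [w2 [wE]]]; rewrite -edge0 endpoint_fst => edge1.
  move: okw12; rewrite wE okw_cat /= => /and3P[okw1 okz _].
  have [[eqy eqz]|[eqy eqz]] := act_edge_inj (@level_actK m) edge1.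
    by exists w1; rewrite -eqz /endpoint run_cat.
  (* Here [e] is traversed towards [y0], so [z] is appended to arrive there. *)
  exists (w1 ++ [:: z]); rewrite okw_cat okw1 /= okz /endpoint !run_cat /=.
  rewrite -/(endpoint _ _) eqy eqz okV okz; split=> //.
  by rewrite -[X in level_act _ X]linvK level_actK.
have Wclosed k u1 u2 : v \notin inc k -> u1 \in inc k -> u2 \in inc k ->
    u1 \in W -> u2 \in W.
  rewrite !inE => nkv ku1 ku2 /andP[_ odd1].
  rewrite (subsetP (incU k)) //=; apply: contraNneq odd1 => even2.
  rewrite -even2; apply/negP => /negP; rewrite eq_sym => odd12.
  have [w [okw1 wE _]] := trav k u1 u2 ku1 ku2 odd12.
  by apply: (stuck nkv ku1 okv0 okw1); rewrite wE.
have subW : W \subset U :\ v.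
  apply/subsetP => u1; rewrite !inE => /andP[-> odd1]; rewrite andbT.
  by apply: contraNneq odd1 => ->.
have [W0|WU] := irreducible subW Wclosed.
  by apply/eqP/negPn; move/setP/(_ u): W0; rewrite !inE Uu /= => ->.
(* Every hyperedge at [v] with a further variable traverses [e] in its piece, so [x0] may follow
   [w0]. *)
case/asboolP: nDy1; exists (w0 ++ [:: x0]); last first.
  by rewrite catA /endpoint run_cat -/(endpoint _ _) y0E.
move=> k kv inc1; rewrite okw_cat okv0 //= andbT.
have [u1 ku1 nu1v] : exists2 u1, u1 \in inc k & u1 != v.
  apply/exists_inP; apply: contraNT inc1.
  rewrite negb_exists_in => /forall_inP all1.
  apply/eqP/setP => u1; rewrite inE; apply/idP/eqP => [/all1|-> //].
  by rewrite negbK => /eqP.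
have : u1 \in W by rewrite WU !inE nu1v (subsetP (incU k)).
rewrite inE => /andP[_ odd1]; have [w [_ wE]] := trav k v u1 kv ku1 odd1.
(* Equal endpoints give equal states, so [x0] is allowed after [w0] as it is after [w]. *)
have /endpoint_delta/(_ (run delta (st k v) (winv (x v)))) :
  endpoint m (x v ++ w) = endpoint m (x v ++ w0) by rewrite wE.
by rewrite !run_cat run_winvK // => ->.
Qed.

(* The path from [x v] to [x u] crosses the boundary of [D] an even number of
   times. *)
Lemma stuck_reach u : u \in U ->
  exists2 w, okv w & endpoint m (x v ++ w) = endpoint m (x u).
Proof.
move=> Uu; apply/asboolP; rewrite -/(D _).
have xuE : run (@level_act m.+1) (endpoint m.+1 (x v)) (winv (x v) ++ x u) =
    endpoint m.+1 (x u).
  by rewrite run_cat run_winv //; apply: level_actK.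
have := crossing_parity D (endpoint m.+1 (x v)) (winv (x v) ++ x u).
rewrite -run_level_fst xuE !endpoint_fst => ->.
rewrite big1 ?addbF => [|e /(boundary_flow Uu) ->]; last exact: addbb.
by apply/asboolP; exists [::]; rewrite ?cats0.
Qed.

(** Labels of paths in [D] from the place of [v] to those of the variables serve as values in
    $F$. *)
Lemma stuck_solution : v \in U -> exists y, solution (@fg_act A) inc st y.
Proof.
move=> Uv.
have /choice[wd wdP] : forall u, exists w,
    u \in U -> okv w /\ endpoint m (x v ++ w) = endpoint m (x u).
  move=> u; have [Uu|] := boolP (u \in U); last by exists [::].
  by have [w] := stuck_reach Uu; exists w.
exists (fun u => word_value (wd u)) => k u u' ku ku'.
have inU := subsetP (incU k).
have [kv|nkv] := boolP (v \in inc k); last first.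
  have [okvu wuE] := wdP u (inU _ ku).
  (* A hyperedge avoiding [v] has no variable at all, since its piece would meet [D] there. *)
  by have := @stuck k u (wd u) [::] nkv ku okvu isT; rewrite cats0 wuE.
have [inc1|ninc1] := eqVneq (inc k) [set v].
  by move: ku ku'; rewrite inc1 !inE => /eqP -> /eqP ->; exact: conn_refl.
have from_v u1 : u1 \in inc k ->
    conn (@fg_act A) (st k v) 1 (st k u1) (word_value (wd u1)).
  move=> ku1; have [okvu wuE] := wdP u1 (inU _ ku1).
  exists (wd u1); split => //; first exact: okvu.
  have [w [_ <- wE]] := sol kv ku1.
  have /endpoint_delta/(_ (run delta (st k v) (winv (x v)))) :
    endpoint m (x v ++ wd u1) = endpoint m (x v ++ w).
    by rewrite wuE -endpoint_fst -wE run_level_fst endpoint_fst -run_cat.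
  by rewrite !run_cat run_winvK.
apply: conn_trans (from_v _ ku'); apply: conn_sym; first exact: fg_actK.
exact: from_v.
Qed.

End Stuck.

(** The induction measure: dropping variables or adding an incidence lowers it. *)
Definition excess (U : {set V}) inc : nat := (#|U| + \sum_k #|U :\: inc k|)%N.

Lemma excess_proper (U U' : {set V}) inc :
  U' \proper U -> (excess U' (fun k => inc k :&: U') < excess U inc)%N.
Proof.
move=> ltU; rewrite /excess -addSn leq_add ?proper_card //.
apply: leq_sum => k _; apply: subset_leq_card; rewrite setDIr setDv setU0.
exact/setSD/proper_sub.
Qed.

Theorem solution_lift m (U : {set V}) inc st (x : V -> seq (letter A)) :
    (forall k, inc k \subset U) -> (excess U inc <= m)%N ->
    solution (@level_act m) inc st (fun u => endpoint m (x u)) ->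
  exists y, solution (@fg_act A) inc st y.
Proof.
elim: m U inc st x => [|m IHm] U inc st x incU leUm sol.
  move: leUm; rewrite leqn0 addn_eq0 cards_eq0 => /andP[/eqP U0 _].
  exists (fun=> 1) => k u u' ku.
  by have := subsetP (incU k) _ ku; rewrite U0 inE.
(* Forgetting the top parities gives a solution at level [m], as the induction hypothesis needs. *)
have solm : solution (@level_act m) inc st (fun u => endpoint m (x u)).
  move=> k u u' ku ku'; have [w [okw1 qE wE]] := sol _ _ _ ku ku'.
  exists w; split=> //.
  by rewrite -[RHS]endpoint_fst -wE run_level_fst endpoint_fst.
have [U0|[v Uv]] := set_0Vmem U.
  exists (fun=> 1) => k u u' ku.
  by have := subsetP (incU k) _ ku; rewrite U0 inE.
have sub_lift (U' : {set V}) : U' \proper U -> exists y,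
    solution (@fg_act A) (fun k => inc k :&: U') st y.
  move=> ltU; apply: (IHm U' _ _ x) => [k||]; first exact: subsetIr.
    by rewrite -ltnS; apply: leq_trans leUm; apply: excess_proper.
  by apply: solution_sub solm => k; apply: subsetIl.
have [[W [subW Wclosed W0 WU]]|irr] := EM (exists W : {set V},
    [/\ W \subset U :\ v,
        (forall k u u', v \notin inc k -> u \in inc k -> u' \in inc k ->
          u \in W -> u' \in W), W <> set0 & W <> U :\ v]).
  have nWv : v \notin W by apply/negP => /(subsetP subW); rewrite !inE eqxx.
  have [y1 sol1] :
      exists y, solution (@fg_act A) (fun k => inc k :&: (v |: W)) st y.
    apply: sub_lift; rewrite properEneq; apply/andP; split.
      by apply/eqP => UE; apply: WU; rewrite -UE setU1K.
    by apply/subsetP => u /setU1P[-> //|/(subsetP subW)/setD1P[]].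
  have [y2 sol2] :
      exists y, solution (@fg_act A) (fun k => inc k :&: (U :\: W)) st y.
    apply: sub_lift; rewrite properE subsetDl /=; apply/negP => /subsetP UW.
    apply: W0; apply/setP => u; rewrite inE; apply/negP => Wu.
    have /setD1P[_ Uu] := subsetP subW _ Wu.
    by have := UW _ Uu; rewrite inE Wu.
  apply: (solution_glue nWv Wclosed sol1 (y2 := y2)).
  apply: solution_sub sol2 => k; apply/subsetP => u.
  by rewrite !inE => /andP[-> ku]; rewrite ku (subsetP (incU k)).
have [[k [u [w [w' [nkv ku okvw okw' eqp]]]]]|stuck] := EM (exists k u w w',
    [/\ v \notin inc k, u \in inc k, okv inc st v w, okw (st k u) w' &
        endpoint m (x u ++ w') = endpoint m (x v ++ w)]).
  (* [v] moves to where [D] meets the piece of [k] and joins [k] in the state reached by [w']. *)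
  pose x' u := if u == v then x v ++ w else x u.
  have [|||y soly] := IHm U (moved_inc inc v k)
      (moved_st inc st v w k (run delta (st k u) w')) x'.
  - move=> k1; rewrite /moved_inc; case: eqP => // _.
    by rewrite subUset sub1set Uv incU.
  - rewrite -ltnS; apply: leq_trans leUm.
    rewrite /excess ltn_add2l (bigD1 k) //= [X in (_ < X)%N](bigD1 k) //=.
    rewrite /moved_inc eqxx.
    rewrite -addSn leq_add //.
      apply: proper_card; apply/properP; split; first exact/setDS/subsetUr.
      by exists v; rewrite !inE ?Uv ?nkv ?eqxx.
    by apply: leq_sum => k1 /negbTE ->.
  - have := @solution_move _ _ (@level_actK m) inc st v w k
      (run delta (st k u) w') nkv okvw (fun u => endpoint m (x u)) u ku.
    rewrite -run_cat -/(endpoint _ _) -eqp /endpoint run_cat.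
    move=> /(_ (conn_run _ _ okw') solm).
    rewrite -run_cat -/(endpoint _ _) eqp.
    move=> solM k1 u1 u2 ku1 ku2; have := solM k1 u1 u2 ku1 ku2.
    by rewrite /x'; do 2!case: eqP.
  - exists (fun u1 => if u1 == v then run (@fg_act A) (y v) (winv w) else y u1).
    by apply: solution_unmove soly => //; apply: fg_actK.
apply: (stuck_solution incU sol _ _ Uv) =>
    [W subW Wclosed|k u w w' nkv ku okvw okw' eqp].
  have [->|W0] := eqVneq W set0; [by left | right].
  by apply: contra_notP irr => WU; exists W; split => //; apply/eqP.
by apply: stuck; exists k, u, w, w'.
Qed.

End Lifting.

End PartialAutomaton.

(** * Finite automata recognising cosets *)

Lemma extend_injection (T : finType) (D : {set T}) (f : T -> T) :
  {in D &, injective f} ->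
  exists s s' : T -> T, [/\ cancel s s', cancel s' s & {in D, s =1 f}].
Proof.
move=> injf; pose E := enum (~: D); pose E' := enum (~: (f @: D)).
have sizeE : size E = size E'.
  rewrite /E /E' -!cardE; apply: (@addnI #|D|).
  by rewrite cardsC -(card_in_imset injf) cardsC.
(* The complements of [D] and of its image have equal size and are matched in enumeration order. *)
pose s t := if t \in D then f t else nth t E' (index t E).
have Em t : t \notin D -> t \in E by rewrite mem_enum inE.
have sE' t : t \notin D -> s t \notin f @: D.
  move=> nDt; rewrite /s (negbTE nDt).
  have : nth t E' (index t E) \in E' by rewrite mem_nth // -sizeE index_mem Em.
  by rewrite mem_enum inE.
have sD t : t \in D -> s t \in f @: D by move=> Dt; rewrite /s Dt imset_f.
have inj_s : injective s.
  move=> t u; case: (boolP (t \in D)) (boolP (u \in D)) => [Dt|nDt] [Du|nDu].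
  - by rewrite /s Dt Du; apply: injf.
  - by move=> eqs; have := sD t Dt; rewrite eqs (negbTE (sE' u nDu)).
  - by move=> eqs; have := sD u Du; rewrite -eqs (negbTE (sE' t nDt)).
  rewrite /s (negbTE nDt) (negbTE nDu) (set_nth_default u); last first.
    by rewrite -sizeE index_mem Em.
  move/eqP; rewrite nth_uniq ?enum_uniq -?sizeE ?index_mem ?Em // => /eqP eqi.
  by rewrite -(nth_index u (Em t nDt)) eqi nth_index ?Em.
exists s, (invF inj_s); split; [exact: invF_f | exact: f_invF|].
by move=> t Dt; rewrite /s Dt.
Qed.

Lemma finitely_generated_subgroup (G : groupType) (H : set G) :
  finitely_generated H -> subgroup H.
Proof.
case=> B _ ->; split=> [|x y].
  rewrite classical_sets.in_setE => M [[M1 _] _].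
  by rewrite classical_sets.in_setE in M1.
rewrite !classical_sets.in_setE => Bx By M BM.
have [[_ MV] _] := BM; have := MV x y; rewrite !classical_sets.in_setE.
by apply; [apply: Bx | apply: By].
Qed.

Section CosetAutomaton.
Variable A : finType.
Local Notation F := (free_group A).
Implicit Types (S : set F) (y z : F) (x : letter A).

(** The set $Sy$. The translates of a subgroup are its right cosets, the vertices of its Schreier
    graph. *)
Definition rtranslate S y : set F := [set z | S (z * y^-1)]%classic.

Lemma rtranslateM S y z : rtranslate (rtranslate S y) z = rtranslate S (y * z).
Proof. by apply/predeqP => t; rewrite /rtranslate /= invgM mulgA. Qed.

Lemma rtranslate1 S : rtranslate S 1 = S.
Proof. by apply/predeqP => t; rewrite /rtranslate /= invg1 mulg1. Qed.

Lemma fg_genV x : fg_gen x * fg_gen (linv x) = 1.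
Proof. by apply: fgword_inj; rewrite /= eqxx. Qed.

Section Translates.
Variable s : seq (set F).

Definition translate_ok (q : seq_sub s) x : bool :=
  rtranslate (val q) (fg_gen x) \in s.

(* In each letter, right translation is a partial injection of the finite set
   [s]; it extends to a permutation. *)
Lemma translate_action : exists delta : seq_sub s -> letter A -> seq_sub s,
  [/\ letter_action delta,
      forall q x, translate_ok (delta q x) (linv x) = translate_ok q x &
      forall q x, translate_ok q x ->
        val (delta q x) = rtranslate (val q) (fg_gen x)].
Proof.
have ext a : exists sg : (seq_sub s -> seq_sub s) * (seq_sub s -> seq_sub s),
    [/\ cancel sg.1 sg.2, cancel sg.2 sg.1 &
        forall q, translate_ok q (a, false) ->
          val (sg.1 q) = rtranslate (val q) (fg_gen (a, false))].
  pose f (q : seq_sub s) := insubd q (rtranslate (val q) (fg_gen (a, false))).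
  have fE q : translate_ok q (a, false) ->
      val (f q) = rtranslate (val q) (fg_gen (a, false)).
    by rewrite /translate_ok /f val_insubd => ->.
  have injf : {in [set q | translate_ok q (a, false)] &, injective f}.
    move=> q q'; rewrite !inE => okq okq' /(congr1 val); rewrite !fE // => eqq.
    apply: val_inj; rewrite /= -[LHS]rtranslate1 -[RHS]rtranslate1.
    by rewrite -(fg_genV (a, false)) -!rtranslateM eqq.
  have [g [g' [gK g'K gE]]] := extend_injection injf.
  by exists (g, g'); split=> // q okq; rewrite /= gE ?inE // fE.
have [sg sgP] := choice ext.
pose delta q x := if x.2 then (sg x.1).2 q else (sg x.1).1 q.
have deltaK : letter_action delta.
  move=> q [a b]; have [sgK sgK' _] := sgP a.
  by case: b; rewrite /delta /= ?sgK ?sgK'.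
have deltaE q x : translate_ok q x ->
    val (delta q x) = rtranslate (val q) (fg_gen x).
  case: x => a [|] okq; rewrite /delta /=; have [sgK _ sgE] := sgP a;
    last exact: sgE.
  (* An inverse letter is handled by writing [q] as the forward image of [q']. *)
  pose q' : seq_sub s := @SeqSub _ s _ okq.
  have q'E : rtranslate (val q') (fg_gen (a, false)) = val q.
    rewrite /= rtranslateM -[(a, false)]/(linv (a, true)).
    by rewrite fg_genV rtranslate1.
  have okq' : translate_ok q' (a, false).
    by rewrite /translate_ok q'E; apply: valP.
  have -> : q = (sg a).1 q' by apply: val_inj; rewrite sgE.
  by rewrite sgK sgE // rtranslateM (fg_genV (a, false)) rtranslate1.
exists delta; split=> // q x; apply/idP/idP => [okq|okq].
  have := deltaE _ _ okq; rewrite deltaK /translate_ok => ->.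
  have := fg_genV (linv x); rewrite rtranslateM linvK => ->.
  by rewrite rtranslate1; apply: valP.
by rewrite /translate_ok deltaE // rtranslateM fg_genV rtranslate1; apply: valP.
Qed.

End Translates.

Fixpoint trail S (w : seq (letter A)) : seq (set F) :=
  if w is x :: w' then S :: trail (rtranslate S (fg_gen x)) w' else [:: S].

(** The states include all vertices on the loops at $H$ reading the generators and on the path from
    $Hg^{-1}$ to $H$ reading $g$. A label $y$ from $Hg^{-1}$ to $H$ satisfies $Hg^{-1}y=H$, that is
    $y\in gH$. *)
Lemma coset_automaton (K : finType) (g : K -> F) (H : K -> set F) :
    (forall k, finitely_generated (H k)) ->
  exists (Q : finType) (delta : Q -> letter A -> Q) (ok : Q -> letter A -> bool)
      (p q : K -> Q),
    [/\ letter_action delta,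
        forall r x, ok (delta r x) (linv x) = ok r x &
        forall k y, lcoset (g k) (H k) y <->
          conn delta ok (@fg_act A) (p k) 1 (q k) y].
Proof.
move=> fgH; have subH k := finitely_generated_subgroup (fgH k).
have /choice[B BP] : forall k, exists B : seq F,
    H k = smallest (@subgroup F) [set` B]%classic.
  by move=> k; have [C /finite_seqP[B ->] ->] := fgH k; exists B.
have H1 k : H k 1 by have [/asboolP] := subH k.
have HV k y z : H k y -> H k z -> H k (y * z^-1).
  move=> Hy Hz; have [_ /(_ y z)] := subH k.
  by rewrite !classical_sets.in_setE => /(_ Hy Hz).
pose sB k := flatten [seq trail (H k) (fgword b) | b <- B k].
pose sg k := trail (rtranslate (H k) (g k)^-1) (fgword (g k)).
pose s := flatten [seq H k :: sB k ++ sg k | k <- enum K].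
have sP k S : S \in H k :: sB k ++ sg k -> S \in s.
  by move=> kS; apply/flatten_mapP; exists k; rewrite ?mem_enum.
have [delta [deltaK okV deltaE]] := translate_action s.
pose ok := @translate_ok s.
have runE r w : okw delta ok r w ->
    val (run delta r w) = rtranslate (val r) (word_value w).
  elim: w r => [|x w IHw] r /=; first by rewrite rtranslate1.
  by case/andP => okr okw; rewrite IHw // deltaE // rtranslateM word_value_cons.
have trail_ok r w : {subset trail (val r) w <= s} -> okw delta ok r w.
  elim: w r => //= x w IHw r sub; have okr : ok r x.
    by apply: sub; rewrite inE; case: w {IHw} => [|? ?] /=; rewrite !inE eqxx orbT.
  by rewrite okr IHw //= deltaE // => S wS; apply: sub; rewrite inE wS orbT.
have trail_head S w : S \in trail S w by case: w => [|? ?]; rewrite inE eqxx.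
pose q k : seq_sub s := SeqSub (sP k (H k) (mem_head _ _)).
have sgs k S : S \in sg k -> S \in s.
  by move=> kS; apply: (sP k); rewrite inE mem_cat kS !orbT.
pose p k : seq_sub s := SeqSub (sgs k _ (trail_head _ _)).
have connE r r' w : {subset trail (val r) w <= s} ->
    rtranslate (val r) (word_value w) = val r' ->
    conn delta ok (@fg_act A) r 1 r' (word_value w).
  move=> /trail_ok okr rE; exists w; split=> //; apply: val_inj.
  by rewrite runE.
have rtrH k y : H k y -> rtranslate (H k) y = H k.
  move=> Hy; apply/predeqP => z; rewrite /rtranslate /=.
  split=> [Hz|/HV]; last exact.
  have HVy : H k y^-1 by rewrite -[y^-1]mul1g; apply: HV.
  by rewrite -[z](mulgVK y) -{2}[y]invgK; apply: HV.
exists (seq_sub s), delta, ok, p, q; split=> // k y.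
have conn_g : conn delta ok (@fg_act A) (p k) 1 (q k) (g k).
  rewrite -[g k]word_value_fgword; apply: connE; first exact: sgs.
  by rewrite word_value_fgword /= rtranslateM mulVg rtranslate1.
(* Labels of loops at [q k] form a subgroup containing the generators. *)
have conn_H h : H k h -> conn delta ok (@fg_act A) (q k) 1 (q k) h.
  rewrite {1}BP; apply; split=> [|b Bb]; last first.
    rewrite -[b]word_value_fgword; apply: connE => [S bS|].
      apply: (sP k); rewrite inE mem_cat; apply/orP; right; apply/orP; left.
      by apply/flatten_mapP; exists b.
    by rewrite word_value_fgword /= rtrH // BP => M [_]; apply.
  split=> [|y1 z1]; first by rewrite classical_sets.in_setE; apply: conn_refl.
  rewrite !classical_sets.in_setE => conn_y conn_z; apply: conn_trans conn_y _.
  apply: conn_sym => //; first exact: fg_actK.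
  have /(conn_mul (y1 * z1^-1)) := conn_z.
  by rewrite mulg1 mulgVK.
split=> [[h Hh <-]|[w [okw1 /(congr1 val)]]].
  by apply: conn_trans conn_g _; rewrite -{1}[g k]mulg1; apply/conn_mul/conn_H.
rewrite runE //= rtranslateM => HE wE.
have {}wE : word_value w = y by rewrite -wE run_fg_act mul1g.
exists ((g k)^-1 * y); last by rewrite mulVKg.
have := H1 k; rewrite -[X in X 1]HE /rtranslate /= wE mul1g.
move/(HV _ _ _ (H1 k)).
by rewrite mul1g invgK.
Qed.

End CosetAutomaton.

(** * Products along closed paths and vertex potentials *)

Section Potential.
Variable E : fin_graph.
Local Notation V := (vertex E).

(** Unlike closed paths, walks may be empty and name their ends, so they concatenate. *)
Fixpoint walk (u : V) (p : seq (edge E)) (v : V) : bool :=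
  if p is k :: p' then (src k == u) && walk (tgt k) p' v else u == v.

Definition walk_rev (p : seq (edge E)) : seq (edge E) :=
  rev (map (@einv E) p).

Lemma walk_cat u p v q w : walk u p v -> walk v q w -> walk u (p ++ q) w.
Proof.
elim: p u => [|k p IHp] u /= => [/eqP -> //|/andP[-> wp] wq].
exact: IHp wp wq.
Qed.

Lemma walk_revP u p v : walk u p v -> walk v (walk_rev p) u.
Proof.
elim: p u => [|k p IHp] u /=; first by rewrite eq_sym.
case/andP => /eqP <- /IHp wp; rewrite /walk_rev /= rev_cons -cats1.
apply: walk_cat wp _; rewrite /= -tgt_einv eqxx /=.
by rewrite [src k]src_einv.
Qed.

Lemma walk_cons u k p v :
  walk u (k :: p) v =
    [&& src k == u, path (fun k k' => tgt k == src k') k p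
      & tgt (last k p) == v].
Proof.
elim: p u k => [|k' p IHp] u k //=; congr andb.
by have := IHp (tgt k) k'; rewrite /= [src k' == _]eq_sym andbA.
Qed.

Lemma closed_walk u p : walk u p u -> p != [::] -> closed_path p.
Proof.
case: p => // k p; rewrite walk_cons => /and3P[/eqP srck pathp /eqP tgtp] _.
by rewrite /closed_path /= rcons_path pathp tgtp srck eqxx.
Qed.

Lemma closed_pathP p : closed_path p -> exists u, walk u p u.
Proof.
case: p => // k p; rewrite /closed_path /= rcons_path => /andP[pathp tgtp].
exists (src k); have /= -> := walk_cons (src k) k p (src k).
by rewrite eqxx pathp.
Qed.

(** The potential at a vertex is the product along a walk from the root of its component. *)
Lemma potentialP (G : groupType) (X : edge E -> G) :
  (forall p, closed_path p -> \prod_(k <- p) X k = 1) <->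
  exists phi : V -> G, forall k, X k = (phi (src k))^-1 * phi (tgt k).
Proof.
split=> [closedX|[phi Xphi] p /closed_pathP[u]]; last first.
  suff prodE w : walk u p w -> \prod_(k <- p) X k = (phi u)^-1 * phi w.
    by move/prodE => ->; rewrite mulVg.
  elim: p u => [|k p IHp] u /=; first by move/eqP->; rewrite big_nil mulVg.
  case/andP => /eqP <- /IHp; rewrite big_cons Xphi => ->.
  by rewrite -mulgA mulVKg.
have XV p : \prod_(k <- walk_rev p) X k = (\prod_(k <- p) X k)^-1.
  elim: p => [|k p IHp]; first by rewrite !big_nil invg1.
  rewrite /walk_rev /= rev_cons -cats1 big_cat /= -/(walk_rev p) IHp.
  rewrite big_seq1 big_cons invgM; congr (_ * _).
  have closedk : closed_path [:: k; einv k].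
    by rewrite /closed_path /= -tgt_einv -src_einv !eqxx.
  have := closedX _ closedk; rewrite big_cons big_seq1 => XX.
  by rewrite -[RHS]mulg1 -XX mulKg.
pose linked u v := `[< exists p, walk u p v >].
have linked_refl v : linked v v by apply/asboolP; exists [::]; rewrite /= eqxx.
pose rep v := choose (linked^~ v) v.
have /choice[pw pwP] : forall v, exists p, walk (rep v) p v.
  by move=> v; apply/asboolP/(@chooseP _ (linked^~ v)).
exists (fun v => \prod_(k <- pw v) X k) => k.
(* Both ends of [k] are linked to the same vertices, and [choose] depends only on that set. *)
have repk : rep (src k) = rep (tgt k).
  have eq_linked : linked^~ (src k) =1 linked^~ (tgt k).
    move=> u; apply/asboolP/asboolP => [] [p wp].
      by exists (p ++ [:: k]); apply: walk_cat wp _; rewrite /= !eqxx.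
    exists (p ++ [:: einv k]); apply: walk_cat wp _.
    by rewrite /= -tgt_einv -src_einv !eqxx.
  rewrite /rep (eq_choose eq_linked); apply: choose_id => //=.
  by rewrite -eq_linked.
have wk : walk (rep (src k)) (pw (src k) ++ k :: walk_rev (pw (tgt k)))
    (rep (src k)).
  apply: walk_cat (pwP _) _; rewrite /= eqxx /= repk; exact/walk_revP/pwP.
have nil : pw (src k) ++ k :: walk_rev (pw (tgt k)) != [::] by case: (pw _).
have := closedX _ (closed_walk wk nil).
rewrite big_cat big_cons /= XV.
set P := \prod_(k <- pw (src k)) X k; set P' := \prod_(k <- pw (tgt k)) X k.
move=> prod1; rewrite -[X k](mulgVK P'); congr (_ * _).
by rewrite -[LHS](mulKg P) prod1 mulg1.
Qed.

End Potential.

(** * Kernels of finite actions *)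

Section Kernel.
Variables (A T : finType) (act : T -> letter A -> T).
Hypothesis actK : letter_action act.

Definition action_kernel : set (free_group A) :=
  [set y | forall t, run act t (fgword y) = t]%classic.

Lemma run_fgV t (y : free_group A) :
  run act (run act t (fgword y)) (fgword y^-1) = t.
Proof. by rewrite -run_fgM // mulgV. Qed.

Lemma action_kernel_normal : normal_subgroup action_kernel.
Proof.
split=> [|y z Ny t]; last by rewrite /conjg !run_fgM // Ny -run_fgM // mulVg.
split=> [|y z]; first by rewrite classical_sets.in_setE.
rewrite !classical_sets.in_setE => Ny Nz t.
by rewrite run_fgM // Ny -{1}[t]Nz run_fgV.
Qed.

(** A coset of the kernel consists of the elements inducing one given map of [T]. *)
Lemma action_kernel_index : finite_index action_kernel.
Proof.
pose img (y : free_group A) := [ffun t => run act t (fgword y)].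
pose fiber c := [set y | img y = c]%classic.
apply: (@sub_finite_set _ _ (fiber @` [set: {ffun T -> T}])%classic); last first.
  exact/finite_image/finite_finset.
move=> _ [y _ <-]; exists (img y) => //; apply/predeqP => z.
split=> [eqz|[n Nn <-]].
  exists (y^-1 * z); last by rewrite mulVKg.
  move=> t; rewrite run_fgM //.
  have /ffunP/(_ (run act t (fgword y^-1))) := eqz.
  by rewrite !ffunE => ->; rewrite -run_fgM // mulVg.
by apply/ffunP => t; rewrite !ffunE run_fgM // Nn.
Qed.

End Kernel.

(** * From solutions modulo $N$ to solutions in $F$ *)

Theorem proposition3p14 (A : finType) (E : fin_graph)
    (ell : edge E -> set (free_group A))
    (g : edge E -> free_group A) (H : edge E -> set (free_group A)) :
  coset_labelling ell g H ->
  exists N : set (free_group A),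
    [/\ normal_subgroup N,
        finite_index N &
        ~ solvable_in (fun k => lcoset (g k) (H k)) ->
        ~ solvable_in (fun k => mulset (lcoset (g k) (H k)) N)].
Proof.
case=> fgH _ _.
have [Q [delta [ok [p [q [deltaK okV gHP]]]]]] := coset_automaton g fgH.
(* Each edge becomes a hyperedge on its ends; a loop yields a single variable. *)
pose inc (k : edge E) : {set vertex E} := [set src k; tgt k].
pose st k u := if u == src k then p k else q k.
pose m := excess [set: vertex E] inc.
have actK : letter_action (@level_act A Q delta m) by apply: level_actK.
exists (action_kernel (@level_act A Q delta m)).
split; [exact: action_kernel_normal | exact: action_kernel_index |].
apply: contra_not => -[X [/potentialP[phi Xphi] gHNX]].
pose tau u := endpoint delta m (fgword (phi u)).
have conn_edge k :
    conn delta ok (@level_act A Q delta m)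
      (p k) (tau (src k)) (q k) (tau (tgt k)).
  (* In $X_k=zn$ the factor $n\in N$ acts trivially on the level, so a path labelled $z$ joins the
     ends. *)
  have [z gHz [n Nn zn]] := gHNX k.
  have [w [okw1 wq wz]] := (gHP k z).1 gHz; exists w; split=> //.
  rewrite /tau; have -> : phi (tgt k) = phi (src k) * (word_value w * n).
    by rewrite -[word_value w]/(run _ 1 w) wz zn Xphi mulVKg.
  by rewrite /endpoint !run_fgM // Nn run_word_value.
(* Around a loop [w] fixes a point of the level, hence every state. *)
have loop k : src k = tgt k -> p k = q k.
  move=> eqk; have [w [_ <- wE]] := conn_edge k.
  move: wE; rewrite -eqk /tau /endpoint -run_cat => /(endpoint_delta (m := m)).
  move/(_ (run delta (p k) (winv (fgword (phi (src k)))))).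
  by rewrite run_cat !run_winvK.
have st_tgt k : st k (tgt k) = q k by rewrite /st; case: eqP => // /esym/loop.
have st_src k : st k (src k) = p k by rewrite /st eqxx.
have sol : solution delta ok (@level_act A Q delta m) inc st
    (fun u => endpoint delta m (fgword (phi u))).
  move=> k u u' /set2P[] -> /set2P[] ->; rewrite ?st_src ?st_tgt.
  - exact: conn_refl.
  - exact: conn_edge.
  - by apply: conn_sym => //; apply: conn_edge.
  - exact: conn_refl.
have [y soly] :=
  solution_lift deltaK okV (fun k => subsetT (inc k)) (leqnn m) sol.
exists (fun k => (y (src k))^-1 * y (tgt k)); split.
  by apply/potentialP; exists y.
(* Left translation moves the start of the connecting path to $1$. *)
move=> k; apply/gHP; rewrite -(mulVg (y (src k))) -st_src -st_tgt.
by apply/conn_mul/soly; rewrite !inE eqxx ?orbT.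
Qed.
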